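(* Let $G$ be a matroid on $[n]$ with no loops and no multiple points, let $\mathbb{K}$ be a field or commutative ring, and fix a linear order on $[n]$. Then the set $\{\bar{a}_S : S\text{ an nbb set of }G\}$ is linearly independent in the quadratic closure $\bar{A}(G)$.
   Context: $\mathcal{E}$ is the exterior algebra over $\mathbb{K}$ on $e_1,\dots,e_n$; for $S=\{i_1<\dots<i_p\}$, $e_S=e_{i_1}\cdots e_{i_p}$. $\partial(e_{i_1}\cdots e_{i_p})=\sum_{k}(-1)^{k-1}e_{i_1}\cdots\widehat{e_{i_k}}\cdots e_{i_p}$. $\mathcal{I}$ is the ideal generated by $\partial e_S$ for $S$ dependent in $G$; $\mathcal{J}$ is the ideal generated by the degree-two component of $\mathcal{I}$; $\bar{A}(G)=\mathcal{E}/\mathcal{J}$ and $\bar{a}_S$ is the image of $e_S$. A subset $S$ is line-closed if $\operatorname{cl}(\{i,j\})\subseteq S$ for all $i,j\in S$ ($\operatorname{cl}$ = matroid closure); $\operatorname{lc}(S)$ is the intersection of the line-closed sets containing $S$. An increasing subset $S=\{i_1<\dots<i_p\}$ is nbb if $i_k=\min\operatorname{lc}(\{i_k,\dots,i_p\})$ for each $k$. *)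

(* Defs.v *)
From HB Require Import structures.
From mathcomp Require Import all_boot all_order all_algebra.
From mathcomp Require Import generic_quotient ring_quotient ring.
From mathcomp Require Import boolp.

Set Implicit Arguments.
Unset Strict Implicit.
Unset Printing Implicit Defensive.

Import GRing.Theory.

Local Open Scope ring_scope.

(** * Matroids *)

Record matroid (T : finType) := Matroid {
  indep : {set T} -> bool;
  indep0 : indep set0;
  indep_sub : forall A B : {set T}, A \subset B -> indep B -> indep A;
  indep_aug : forall A B : {set T}, indep A -> indep B -> (#|A| < #|B|)%N ->
    exists2 x, x \in B :\: A & indep (x |: A)
}.

Section Matroids.
Variables (T : finType) (G : matroid T).
Implicit Types (S A : {set T}) (i j : T).

Definition dependent S := ~~ indep G S.

Definition mrank A := (\max_(B : {set T} | indep G B && (B \subset A)) #|B|)%N.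

Definition mcl A := [set i | mrank (i |: A) == mrank A].

Definition is_loop i := dependent [set i].

(* A multiple point is a class of at least two parallel elements *)
Definition parallel i j :=
  [&& i != j, ~~ is_loop i, ~~ is_loop j & dependent [set i; j]].

Definition simple_matroid :=
  (forall i, ~~ is_loop i) /\ (forall i j, ~~ parallel i j).

Definition line_closed S :=
  [forall i in S, forall j in S, mcl [set i; j] \subset S].

Definition lc S := \bigcap_(A : {set T} | line_closed A && (S \subset A)) A.

Variable ord : rel T.

Definition is_min i A := (i \in A) && [forall j in A, ord i j].

Definition nbb S := [forall i in S, is_min i (lc [set j in S | ord i j])].

End Matroids.

Definition linear_order (T : Type) (ord : rel T) :=
  [/\ reflexive ord, antisymmetric ord, transitive ord & total ord].

(** * The exterior algebra on e_0, ..., e_(n-1) *)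

(* The K-algebra generated by the e_i subject to e_i e_i = 0 and
   e_i e_j = - e_j e_i ([ext_gen_sqr], [ext_gen_anti]). An element is given by
   its coordinates on the monomials, indexed by subsets of 'I_n and written with
   increasing indices for the usual order of 'I_n ([ext_prod_enum]). *)
Definition exterior (K : comPzRingType) (n : nat) := {ffun {set 'I_n} -> K}.

Section Exterior.
Variables (K : comPzRingType) (n : nat).
Local Notation E := (exterior K n).

HB.instance Definition _ := GRing.Lmodule.copy E {ffun {set 'I_n} -> K^o}.

Implicit Types (x y z : E) (S T U A B C : {set 'I_n}) (i j k : 'I_n).

(* Number of transpositions needed to sort e_S e_T *)
Definition ninv S T := (\sum_(i in S) \sum_(j in T) (j < i)%N)%N.

Definition ext_mul x y : E :=
  [ffun U : {set 'I_n} => \sum_(S : {set 'I_n} | S \subset U)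
     (-1) ^+ ninv S (U :\: S) * (x S * y (U :\: S))].

Definition ext_one : E := [ffun S : {set 'I_n} => (S == set0)%:R].

Lemma sumU A B (F : 'I_n -> nat) : [disjoint A & B] ->
  (\sum_(i in A :|: B) F i = \sum_(i in A) F i + \sum_(i in B) F i)%N.
Proof.
by move=> dAB; rewrite -bigU //; apply: eq_bigl => i; rewrite !inE.
Qed.

Lemma ninvUl A B C : [disjoint A & B] ->
  ninv (A :|: B) C = (ninv A C + ninv B C)%N.
Proof. exact: sumU. Qed.

Lemma ninvUr A B C : [disjoint B & C] ->
  ninv A (B :|: C) = (ninv A B + ninv A C)%N.
Proof.
by move=> dBC; rewrite /ninv -big_split; apply: eq_bigr => i _; exact: sumU.
Qed.

Lemma ninv0l A : ninv set0 A = 0%N.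
Proof. by rewrite /ninv big_set0. Qed.

Lemma ninv0r A : ninv A set0 = 0%N.
Proof. by rewrite /ninv big1 // => i _; rewrite big_set0. Qed.

Lemma ext_mulA : associative ext_mul.
Proof.
move=> x y z; apply/ffunP => U; rewrite !ffunE.
under eq_bigr => S _ do rewrite ffunE !mulr_sumr.
under [RHS]eq_bigr => S _ do rewrite ffunE mulr_suml mulr_sumr.
rewrite [RHS](exchange_big_dep (fun A => A \subset U)) /=; last first.
  by move=> S A SU AS; apply: subset_trans SU.
apply: eq_bigr => A AU.
rewrite [RHS](reindex_onto (fun B => A :|: B) (fun S => S :\: A)) /=; last first.
  by move=> S /andP[_ AS]; rewrite setDE setUIr setUCr setIT (setUidPr AS).
apply: eq_big => [B|B].
  rewrite subUset AU subsetUl andbT /= setDUl setDv set0U setDE subsetI.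
  by congr (_ && _); apply/idP/eqP; rewrite -disjoints_subset => /setDidPl.
rewrite subsetD => /andP[BU dBA].
have -> : (A :|: B) :\: A = B.
  by rewrite setDUl setDv set0U; apply/setDidPl.
have UAB : U :\: A = B :|: (U :\: (A :|: B)).
  apply/setP => i; rewrite !inE; case: (boolP (i \in B)) => iB /=.
    by rewrite (subsetP BU) // (disjointFr dBA).
  by rewrite orbF.
have dB : [disjoint B & U :\: (A :|: B)].
  by rewrite -setDDl disjoint_sym disjoints_subset setDE subsetIr.
rewrite setDDl {1}UAB ninvUr // ninvUl 1?disjoint_sym //.
rewrite !exprD; ring.
Qed.

Lemma ext_mul1l : left_id ext_one ext_mul.
Proof.
move=> x; apply/ffunP => U; rewrite ffunE (bigD1 set0) ?sub0set //= big1.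
  by rewrite ninv0l ffunE eqxx setD0 mul1r mul1r addr0.
by move=> S /andP[_ /negbTE S0]; rewrite ffunE S0 mul0r mulr0.
Qed.

Lemma ext_mul1r : right_id ext_one ext_mul.
Proof.
move=> x; apply/ffunP => U; rewrite ffunE (bigD1 U) //= big1.
  by rewrite setDv ninv0r ffunE eqxx mul1r mulr1 addr0.
move=> S /andP[SU nSU]; rewrite ffunE setD_eq0.
case: (boolP (U \subset S)) => [US|]; last by rewrite !mulr0.
by rewrite eqEsubset SU US in nSU.
Qed.

Lemma ext_mulDl : left_distributive ext_mul +%R.
Proof.
move=> x y z; apply/ffunP => U; rewrite !ffunE -big_split /=.
by apply: eq_bigr => S _; rewrite ffunE mulrDl mulrDr.
Qed.

Lemma ext_mulDr : right_distributive ext_mul +%R.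
Proof.
move=> x y z; apply/ffunP => U; rewrite !ffunE -big_split /=.
by apply: eq_bigr => S _; rewrite ffunE !mulrDr.
Qed.

HB.instance Definition _ := GRing.Zmodule_isPzRing.Build E
  ext_mulA ext_mul1l ext_mul1r ext_mulDl ext_mulDr.

Lemma ext_mulE x y U : (x * y) U = \sum_(S : {set 'I_n} | S \subset U)
  (-1) ^+ ninv S (U :\: S) * (x S * y (U :\: S)).
Proof. by rewrite ffunE. Qed.

Lemma ext_scaleE a x U : (a *: x) U = a * x U.
Proof. by rewrite ffunE. Qed.

Lemma ext_scalerAl a x y : a *: (x * y) = (a *: x) * y.
Proof.
apply/ffunP => U; rewrite !(ext_scaleE, ext_mulE) mulr_sumr.
by apply: eq_bigr => S _; rewrite ext_scaleE; ring.
Qed.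

Lemma ext_scalerAr a x y : a *: (x * y) = x * (a *: y).
Proof.
apply/ffunP => U; rewrite !(ext_scaleE, ext_mulE) mulr_sumr.
by apply: eq_bigr => S _; rewrite ext_scaleE; ring.
Qed.

Definition ext_gen i : E := [ffun S : {set 'I_n} => (S == [set i])%:R].

(* The coordinate on U collects the monomials of the sets i |: U, from which i is
   deleted; [ext_d_prod] below gives the usual alternating sum on any monomial
   e_(i_1) ... e_(i_p), whatever the order of its indices. *)
Definition ext_d x : E :=
  [ffun U : {set 'I_n} =>
     \sum_(i | i \notin U) (-1) ^+ ninv [set i] U * x (i |: U)].

Lemma ext_dE x U :
  ext_d x U = \sum_(i | i \notin U) (-1) ^+ ninv [set i] U * x (i |: U).
Proof. by rewrite ffunE. Qed.

Lemma ext_genM i x U : (ext_gen i * x) U =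
  if i \in U then (-1) ^+ ninv [set i] (U :\ i) * x (U :\ i) else 0.
Proof.
rewrite ext_mulE; case: ifPn => iU.
  rewrite (bigD1 [set i]) ?sub1set //= big1 ?ffunE ?eqxx ?mul1r ?addr0 //.
  by move=> S /andP[_ /negbTE Si]; rewrite ffunE Si mul0r mulr0.
rewrite big1 // => S SU; rewrite ffunE; case: eqP => [Si|]; rewrite ?mul0r ?mulr0 //.
by rewrite Si sub1set (negbTE iU) in SU.
Qed.

Lemma ext_gen_sqr i : ext_gen i * ext_gen i = 0.
Proof.
apply/ffunP => U; rewrite ext_genM [in RHS]ffunE; case: ifP => // iU.
rewrite ffunE; case: eqP => [/setP/(_ i)|]; last by rewrite mulr0.
by rewrite !inE eqxx.
Qed.

Lemma ninv1U k i U : i \notin U ->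
  ninv [set k] (i |: U) = ((i < k) + ninv [set k] U)%N.
Proof.
move=> iU; rewrite ninvUr ?disjoints1 //.
by rewrite /ninv big_set1 big_set1.
Qed.

Lemma ext_gen_anti i j : ext_gen i * ext_gen j = - (ext_gen j * ext_gen i).
Proof.
case: (eqVneq i j) => [->|nij]; first by rewrite ext_gen_sqr oppr0.
apply/ffunP => U; rewrite [in RHS]ffunE !ext_genM !ffunE.
have E2 (k l : 'I_n) : l != k -> k \in U ->
    (U :\ k == [set l]) = (U == [set k; l]).
  move=> lk kU; apply/eqP/eqP => [<-|->]; first by rewrite setD1K.
  by rewrite setU1K // inE eq_sym.
case: (boolP (U == [set i; j])) => [/eqP UE|nU].
  have iU : i \in U by rewrite UE !inE eqxx.
  have jU : j \in U by rewrite UE !inE eqxx orbT.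
  have Ui : U :\ i = [set j] by apply/eqP; rewrite E2 1?eq_sym // UE eqxx.
  have Uj : U :\ j = [set i] by apply/eqP; rewrite E2 // UE setUC eqxx.
  rewrite iU jU Ui Uj !eqxx /ninv !big_set1 !mulr1.
  have : val i != val j by [].
  by case: ltngtP => //= _ _; rewrite ?expr1 ?expr0 ?opprK.
have nU' : U != [set j; i] by rewrite setUC.
case: ifP => iU; case: ifP => jU;
  by rewrite ?E2 ?(negbTE nU) ?(negbTE nU') ?mulr0 ?oppr0 // eq_sym.
Qed.

Lemma ext_d_genM i x : ext_d (ext_gen i * x) = x - ext_gen i * ext_d x.
Proof.
apply/ffunP => U; rewrite ext_dE [in RHS]ffunE [in RHS]ffunE ext_genM.
case: (boolP (i \in U)) => iU; last first.
  rewrite (bigD1 i) //= big1 ?addr0 ?subr0.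
    rewrite ext_genM setU11 setU1K // mulrA -exprD addnn -mul2n exprM sqrrN.
    by rewrite !expr1n mul1r.
  move=> k /andP[kU ki]; rewrite ext_genM in_setU1 (negbTE iU) orbF eq_sym.
  by rewrite (negbTE ki) mulr0.
set V := U :\ i; have iV : i \notin V by rewrite !inE eqxx.
have UE : U = i |: V by rewrite setD1K.
rewrite !ext_dE [in RHS](bigD1 i) //= -UE mulrDr mulrA -exprD addnn -mul2n exprM sqrrN.
rewrite !expr1n mul1r opprD addNKr mulr_sumr -sumrN.
apply: eq_big => [k|k kU]; first by rewrite UE !inE negb_or andbC.
have ki : k != i by apply: contraNneq kU => ->.
have kV : k \notin V by rewrite !inE negb_and kU orbT.
rewrite ext_genM in_setU1 iU orbT.
have -> : (k |: U) :\ i = k |: V.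
  by rewrite UE setUCA setU1K // in_setU1 negb_or eq_sym ki.
rewrite {1}UE !ninv1U //.
have: (k < i)%N = ~~ (i < k)%N.
  by rewrite -leqNgt ltn_neqAle -[X in ~~ X]/(k == i) ki.
by move=> ->; rewrite !exprD; case: (i < k)%N => /=; ring.
Qed.

Definition ext_prod (s : seq 'I_n) : E := \prod_(i <- s) ext_gen i.

Lemma ext_prod_enum S : ext_prod (enum S) = [ffun T => (T == S)%:R].
Proof.
have: sorted ltn (map val (enum S)).
  have -> : enum S = filter (mem S) (enum 'I_n) by rewrite [in RHS]enumT.
  rewrite sorted_map; apply: sorted_filter; first by move=> i j k; apply: ltn_trans.
  by rewrite -sorted_map val_enum_ord iota_ltn_sorted.
have {3}-> : S = [set i in enum S] by apply/setP => i; rewrite inE mem_enum.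
rewrite /ext_prod; elim: (enum S) => [|i s IHs] /=.
  have -> : [set i : 'I_n in [::]] = set0 by apply/setP => i; rewrite !inE.
  by rewrite big_nil.
rewrite path_sortedE; last exact: ltn_trans.
case/andP=> /allP is_lt /IHs {}IHs; rewrite big_cons IHs set_cons.
have lti j : j \in s -> (i < j)%N by move=> js; apply/is_lt/map_f.
have iNs : i \notin s by apply/negP => /lti; rewrite ltnn.
apply/ffunP => T; rewrite ext_genM !ffunE; case: ifPn => iT; last first.
  by case: eqP => // TE; rewrite TE setU11 in iT.
have -> : (T :\ i == [set j in s]) = (T == i |: [set j in s]).
  apply/eqP/eqP => [<-|->]; first by rewrite setD1K.
  by rewrite setU1K // inE.
case: eqP => [->|]; last by rewrite mulr0.
rewrite setU1K ?inE // mulr1 /ninv big_set1 big1 ?expr0 // => j.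
by rewrite inE => /lti ij; rewrite ltnNge ltnW.
Qed.

Lemma ext_d1 : ext_d 1 = 0.
Proof.
apply/ffunP => U; rewrite !ffunE big1 // => i _; rewrite ffunE.
case: eqP => [/setP/(_ i)|]; last by rewrite mulr0.
by rewrite !inE eqxx.
Qed.

Lemma ext_d_prod (s : seq 'I_n) : ext_d (ext_prod s) =
  \sum_(k < size s) (-1) ^+ k *: ext_prod (take k s ++ drop k.+1 s).
Proof.
rewrite /ext_prod; elim: s => [|i s IHs] /=; first by rewrite big_nil big_ord0 ext_d1.
rewrite big_cons ext_d_genM IHs big_ord_recl /= expr0 scale1r drop0.
congr (_ + _); rewrite mulr_sumr -sumrN; apply: eq_bigr => k _.
by rewrite big_cons -ext_scalerAr exprS mulN1r scaleNr.
Qed.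

End Exterior.

(** * Ideals and quotients *)

Definition two_sided_ideal (A : pzRingType) (I : A -> Prop) :=
  [/\ I 0, forall x y, I x -> I y -> I (x + y),
      forall a x, I x -> I (a * x) & forall a x, I x -> I (x * a)].

Definition ideal_gen (A : pzRingType) (P : A -> Prop) : {pred A} :=
  fun x => `[< forall I : A -> Prop, two_sided_ideal I ->
                 (forall y, P y -> I y) -> I x >].

Section IdealGen.
Variables (A : pzRingType) (P : A -> Prop).

Lemma ideal_genP x : reflect (forall I : A -> Prop, two_sided_ideal I ->
  (forall y, P y -> I y) -> I x) (x \in ideal_gen P).
Proof. exact: asboolP. Qed.

Lemma mem_ideal_gen x : P x -> x \in ideal_gen P.
Proof. by move=> Px; apply/ideal_genP => I _; apply. Qed.

Lemma ideal_genMl a x : x \in ideal_gen P -> a * x \in ideal_gen P.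
Proof.
move/ideal_genP => Px; apply/ideal_genP => I idI PI.
by case: (idI) => _ _ Ml _; apply: Ml; apply: Px.
Qed.

Lemma ideal_genMr a x : x \in ideal_gen P -> x * a \in ideal_gen P.
Proof.
move/ideal_genP => Px; apply/ideal_genP => I idI PI.
by case: (idI) => _ _ _ Mr; apply: Mr; apply: Px.
Qed.

Lemma ideal_gen_zmod : zmod_closed (ideal_gen P).
Proof.
split=> [|x y Px Py]; first by apply/ideal_genP => I [].
have {}Py : - y \in ideal_gen P by rewrite -mulN1r ideal_genMl.
apply/ideal_genP => I idI PI; case: (idI) => _ D _ _.
by apply: D; [move/ideal_genP: Px|move/ideal_genP: Py]; apply.
Qed.

HB.instance Definition _ :=
  GRing.isZmodClosed.Build A (ideal_gen P) ideal_gen_zmod.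

End IdealGen.

Definition ext_quot (K : comPzRingType) (n : nat) (P : exterior K n -> Prop) :=
  {ideal_quot ideal_gen P}.

Section ExtQuot.
Variables (K : comPzRingType) (n : nat) (P : exterior K n -> Prop).
Local Notation E := (exterior K n).
Local Notation Q := (ext_quot P).

HB.instance Definition _ := GRing.Zmodule.copy Q {ideal_quot ideal_gen P}.

Definition ext_pi (x : E) : Q := \pi_{ideal_quot ideal_gen P}%qT x.

Lemma ext_pi_eq x y : (ext_pi x == ext_pi y) = (x - y \in ideal_gen P).
Proof. by rewrite Quotient.idealrBE. Qed.

Lemma ext_piD : {morph ext_pi : x y / x + y}.
Proof. by move=> x y; rewrite /ext_pi; rewrite !piE. Qed.

Lemma ext_pi_surj (q : Q) : exists x, ext_pi x = q.
Proof. by exists (repr q); rewrite /ext_pi reprK. Qed.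

Lemma ext_piK (q : Q) : ext_pi (repr q) = q.
Proof. exact: reprK. Qed.

Definition ext_quot_mul (p q : Q) : Q := ext_pi (repr p * repr q).

Definition ext_quot_scale (a : K) (q : Q) : Q := ext_pi (a *: repr q).

Lemma ext_pi_mul x y : ext_quot_mul (ext_pi x) (ext_pi y) = ext_pi (x * y).
Proof.
apply/eqP; rewrite ext_pi_eq.
set x' := repr _; set y' := repr _.
have Px : x' - x \in ideal_gen P by rewrite -ext_pi_eq ext_piK.
have Py : y' - y \in ideal_gen P by rewrite -ext_pi_eq ext_piK.
have -> : x' * y' - x * y = (x' - x) * y' + x * (y' - y).
  by rewrite mulrBl mulrBr addrA subrK.
by apply: rpredD; [apply: ideal_genMr|apply: ideal_genMl].
Qed.

Lemma ext_pi_scale a x : ext_quot_scale a (ext_pi x) = ext_pi (a *: x).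
Proof.
apply/eqP; rewrite ext_pi_eq -scalerBr -[repr _ - x]mul1r ext_scalerAl.
by apply: ideal_genMl; rewrite -ext_pi_eq ext_piK.
Qed.

Lemma ext_quot_mulA : associative ext_quot_mul.
Proof.
by move=> p q r; rewrite -[p]ext_piK -[q]ext_piK -[r]ext_piK !ext_pi_mul mulrA.
Qed.

Lemma ext_quot_mul1l : left_id (ext_pi 1) ext_quot_mul.
Proof. by move=> p; rewrite -[p]ext_piK ext_pi_mul mul1r. Qed.

Lemma ext_quot_mul1r : right_id (ext_pi 1) ext_quot_mul.
Proof. by move=> p; rewrite -[p]ext_piK ext_pi_mul mulr1. Qed.

Lemma ext_quot_mulDl : left_distributive ext_quot_mul +%R.
Proof.
move=> p q r; rewrite -[p]ext_piK -[q]ext_piK -[r]ext_piK.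
by rewrite -ext_piD !ext_pi_mul mulrDl ext_piD.
Qed.

Lemma ext_quot_mulDr : right_distributive ext_quot_mul +%R.
Proof.
move=> p q r; rewrite -[p]ext_piK -[q]ext_piK -[r]ext_piK.
by rewrite -ext_piD !ext_pi_mul mulrDr ext_piD.
Qed.

HB.instance Definition _ := GRing.Zmodule_isPzRing.Build Q
  ext_quot_mulA ext_quot_mul1l ext_quot_mul1r ext_quot_mulDl ext_quot_mulDr.

Lemma ext_quot_scaleA a b q :
  ext_quot_scale a (ext_quot_scale b q) = ext_quot_scale (a * b) q.
Proof. by rewrite -[q]ext_piK !ext_pi_scale scalerA. Qed.

Lemma ext_quot_scale1 : left_id 1 ext_quot_scale.
Proof. by move=> q; rewrite -[q]ext_piK ext_pi_scale scale1r. Qed.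

Lemma ext_quot_scaleDr : right_distributive ext_quot_scale +%R.
Proof.
move=> a p q; rewrite -[p]ext_piK -[q]ext_piK.
by rewrite -ext_piD !ext_pi_scale scalerDr ext_piD.
Qed.

Lemma ext_quot_scaleDl q : {morph ext_quot_scale^~ q : a b / a + b}.
Proof.
by move=> a b; rewrite -[q]ext_piK !ext_pi_scale scalerDl ext_piD.
Qed.

HB.instance Definition _ := GRing.Zmodule_isLmodule.Build K Q
  ext_quot_scaleA ext_quot_scale1 ext_quot_scaleDr ext_quot_scaleDl.

Lemma ext_piM : {morph ext_pi : x y / x * y}.
Proof. by move=> x y; rewrite -ext_pi_mul. Qed.

Lemma ext_piZ a x : ext_pi (a *: x) = a *: ext_pi x.
Proof. by rewrite -ext_pi_scale. Qed.

End ExtQuot.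

(** * The quadratic closure of the Orlik-Solomon algebra *)

Section QuadraticClosure.
Variables (K : comPzRingType) (n : nat).
Local Notation E := (exterior K n).

Definition homogeneous d (x : E) := forall S, x S != 0 -> #|S| = d.

Variables (ord : rel 'I_n) (G : matroid 'I_n).

(* The factors are in increasing order for [ord], not for the order of 'I_n used
   to encode [exterior]. *)
Definition ext_mon (S : {set 'I_n}) : E := ext_prod K (sort ord (enum S)).

Definition OS_gen (x : E) : Prop :=
  exists2 S : {set 'I_n}, dependent G S & x = ext_d (ext_mon S).

Definition OS_ideal : {pred E} := ideal_gen OS_gen.

Definition OS_ideal2 (x : E) : Prop := x \in OS_ideal /\ homogeneous 2 x.

Definition quad_closure := ext_quot OS_ideal2.

Definition abar (S : {set 'I_n}) : quad_closure := ext_pi OS_ideal2 (ext_mon S).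

End QuadraticClosure.

(* As a family: in particular the v i are pairwise distinct if K is nontrivial. *)
Definition lin_indep (K : pzRingType) (V : lmodType K) (I : finType)
    (P : pred I) (v : I -> V) :=
  forall c : I -> K, \sum_(i | P i) c i *: v i = 0 -> forall i, P i -> c i = 0.

(* Main.v *)
(** [J] is generated by the [ext_d e_ijk] with [i, j, k] collinear, because every
    dependent set of a simple matroid has at least three elements. Each such
    generator is homogeneous for the grading of the exterior algebra in which
    the monomial [e_S] has degree [lc S], and [ext_d] vanishes on it; hence [J] is
    stable under the projections onto the graded pieces and under [ext_d].

    For an nbb set [S = {i_1 < ... < i_p}], alternately project onto degree
    [lc {i_k, ..., i_p}] and apply [ext_d], for [k = 1, ..., p], and finally take
    the coefficient of [1]. This linear form kills [J]. It sends [e_T], with [T]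
    nbb, to [1] if [T = S] and to [0] otherwise: if [lc T = lc S], then [S] and [T]
    have the same minimum [i], and in [ext_d e_T = e_T' - e_i * ext_d e_T'] the
    second term has its degrees containing [i], unlike [lc (S \ {i})]. So the linear
    forms are dual to the nbb monomials. *)

From HB Require Import structures.
Require Import Defs.
From mathcomp Require Import all_boot all_order all_algebra.

Set Implicit Arguments.
Unset Strict Implicit.
Unset Printing Implicit Defensive.

Import GRing.Theory.
Local Open Scope ring_scope.

(** * Line closure in a simple matroid *)

Section LineClosure.
Variables (T : finType) (G : matroid T).
Implicit Types (S A B U : {set T}) (i j : T).

Lemma sub_lc S : S \subset lc G S.
Proof. by apply/bigcapsP => A /andP[]. Qed.

Lemma lc_min S A : line_closed G A -> S \subset A -> lc G S \subset A.
Proof. by move=> cA SA; apply: bigcap_inf; rewrite cA. Qed.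

Lemma line_closed_lc S : line_closed G (lc G S).
Proof.
apply/forall_inP => i /bigcapP iS; apply/forall_inP => j /bigcapP jS.
apply/bigcapsP => A cA; have /andP[/forall_inP AP _] := cA.
by have /forall_inP := AP i (iS A cA); apply; exact: jS.
Qed.

Lemma lc_sub S A : S \subset lc G A -> lc G S \subset lc G A.
Proof. exact/lc_min/line_closed_lc. Qed.

Lemma lc_set0 : lc G set0 = set0.
Proof.
apply/eqP; rewrite -subset0; apply: lc_min; last exact: sub0set.
by apply/forall_inP => i; rewrite inE.
Qed.

Lemma lcU_sub A B A' B' : lc G A = lc G A' -> lc G B = lc G B' ->
  lc G (A :|: B) \subset lc G (A' :|: B').
Proof.
move=> eA eB; apply: lc_sub.
have lcS C D : lc G C = lc G D -> D \subset A' :|: B' -> C \subset lc G (A' :|: B').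
  move=> CD DU; rewrite (subset_trans (sub_lc C)) // CD lc_sub //.
  exact: subset_trans DU (sub_lc _).
by rewrite subUset (lcS _ _ eA) ?subsetUl // (lcS _ _ eB) ?subsetUr.
Qed.

(** This is what makes line closure a grading: the degree of a product of monomials depends only on
    the degrees of its factors. *)
Lemma lcU A B A' B' : lc G A = lc G A' -> lc G B = lc G B' ->
  lc G (A :|: B) = lc G (A' :|: B').
Proof. by move=> eA eB; apply/eqP; rewrite eqEsubset !lcU_sub. Qed.

Lemma mrankS A B : A \subset B -> (mrank G A <= mrank G B)%N.
Proof.
move=> AB; apply/bigmax_leqP => C /andP[iC CA].
by rewrite (@leq_bigmax_cond _ _ (fun C : {set T} => #|C|)) // iC (subset_trans CA).
Qed.

Hypothesis simpleG : simple_matroid G.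

Lemma simple_dependent_card S : dependent G S -> (2 < #|S|)%N.
Proof.
case: simpleG => noloop nopar dS; case: ltngtP => // cS.
  case: (posnP #|S|) => [/eqP|S0].
    by rewrite cards_eq0 => /eqP S0; move: dS; rewrite S0 /dependent indep0.
  have /cards1P[i SE] : #|S| == 1%N by rewrite eqn_leq S0 -ltnS cS.
  by move: (noloop i); rewrite /is_loop -SE dS.
have /cards2P[i [j [ij SE]]] : #|S| == 2%N by rewrite -cS.
by move: (nopar i j); rewrite /parallel ij !noloop /= -SE dS.
Qed.

(** [U] is independent, so it has rank two; the dependent triple [i |: U] has rank at most two as
    well, hence [i] lies in the matroid closure of the pair [U]. *)
Lemma lc_dependent3 i U : i \notin U -> #|U| = 2%N -> dependent G (i |: U) ->
  lc G U = lc G (i |: U).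
Proof.
move=> iU cU dS; apply/eqP; rewrite eqEsubset [X in _ && X]lc_sub; last first.
  rewrite subUset sub_lc andbT sub1set.
  have /cards2P[j [k [_ UE]]] : #|U| == 2%N by rewrite cU.
  have clU : mcl G U \subset lc G U.
    have inU k' : k' \in [set j; k] -> k' \in lc G U.
      by rewrite -UE; apply: subsetP (sub_lc U) k'.
    have /forall_inP/(_ j (inU j (set21 j k)))/forall_inP := line_closed_lc U.
    by rewrite [X in mcl G X]UE; apply; apply/inU; rewrite set22.
  apply: (subsetP clU); rewrite inE eqn_leq (mrankS (subsetUr _ _)) andbT.
  have iU2 : indep G U.
    by apply: contraT => /simple_dependent_card; rewrite cU.
  apply: (@leq_trans 2%N); last first.
    rewrite -cU (@leq_bigmax_cond _ _ (fun C : {set T} => #|C|)) // iU2 /=.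
    exact: subxx.
  apply/bigmax_leqP => B /andP[iB BS].
  rewrite -ltnS (_ : 3%N = #|i |: U|); last by rewrite cardsU1 iU cU.
  apply: proper_card; rewrite properEneq BS andbT.
  by apply: contraTneq iB => ->.
by rewrite andbT lc_sub // (subset_trans _ (sub_lc _)) // subsetUr.
Qed.

End LineClosure.

Lemma ideal_gen_ind (A : pzRingType) (P I : A -> Prop) :
    I 0 -> (forall x y, I x -> I y -> I (x + y)) ->
    (forall a x, I x -> I (a * x)) -> (forall a x, I x -> I (x * a)) ->
    (forall x, P x -> I x) ->
  forall x, x \in ideal_gen P -> I x.
Proof. by move=> I0 ID IMl IMr PI x /ideal_genP; apply. Qed.

(** * Derivation, projections and sign involution on the exterior algebra *)

Section Exterior.
Variables (K : comPzRingType) (n : nat).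
Local Notation E := (exterior K n).
Implicit Types (x y a : E) (S U : {set 'I_n}).

Lemma ext_d_is_linear : linear (@ext_d K n).
Proof.
move=> c x y; apply/ffunP => U.
rewrite [RHS]ffunE ext_scaleE !ext_dE mulr_sumr -big_split /=.
by apply: eq_bigr => i _; rewrite ffunE ext_scaleE mulrDr mulrCA.
Qed.
HB.instance Definition _ := GRing.isLinear.Build K E E *:%R (@ext_d K n)
  ext_d_is_linear.

Definition ext_proj (P : pred {set 'I_n}) x : E :=
  [ffun U => if P U then x U else 0].

Lemma ext_proj_is_linear P : linear (ext_proj P).
Proof.
move=> c x y; apply/ffunP => U; rewrite !ffunE.
by case: ifP => // _; rewrite scaler0 addr0.
Qed.
HB.instance Definition _ P := GRing.isLinear.Build K E E *:%R (ext_proj P)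
  (ext_proj_is_linear P).

Lemma ext_proj_id (P : pred {set 'I_n}) x : (forall U, ~~ P U -> x U = 0) ->
  ext_proj P x = x.
Proof. by move=> Px; apply/ffunP => U; rewrite ffunE; case: ifPn => // /Px. Qed.

Lemma ext_proj_eq0 (P : pred {set 'I_n}) x : (forall U, P U -> x U = 0) ->
  ext_proj P x = 0.
Proof. by move=> Px; apply/ffunP => U; rewrite !ffunE; case: ifPn => // /Px. Qed.

(** The grade involution, which carries the sign in the Leibniz rule [ext_dM]. *)
Definition ext_conj x : E := [ffun U : {set 'I_n} => (-1) ^+ #|U| * x U].

Lemma ext_conj_is_linear : linear ext_conj.
Proof.
move=> c x y; apply/ffunP => U.
by rewrite [RHS]ffunE ext_scaleE ![ext_conj _ U]ffunE ffunE ext_scaleE mulrDr mulrCA.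
Qed.
HB.instance Definition _ := GRing.isLinear.Build K E E *:%R ext_conj
  ext_conj_is_linear.

Lemma ext_conjM x y : ext_conj (x * y) = ext_conj x * ext_conj y.
Proof.
apply/ffunP => U; rewrite [LHS]ffunE !ext_mulE mulr_sumr.
apply: eq_bigr => S SU; rewrite !ffunE.
rewrite -(cardsID S U) (setIidPr SU) exprD.
by rewrite mulrCA -!mulrA; congr (_ * (_ * _)); rewrite mulrCA.
Qed.

Lemma ext_conj_gen i : ext_conj (ext_gen K i) = - ext_gen K i.
Proof.
apply/ffunP => U; rewrite !ffunE; case: eqP => [->|_]; last by rewrite mulr0 oppr0.
by rewrite cards1 expr1 mulr1.
Qed.

Lemma ext_ind (P : E -> Prop) : P 1 -> (forall x y, P x -> P y -> P (x + y)) ->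
  (forall c x, P x -> P (c *: x)) -> (forall i x, P x -> P (ext_gen K i * x)) ->
  forall x, P x.
Proof.
move=> P1 PD PZ PM x.
have -> : x = \sum_(S : {set 'I_n}) x S *: ext_prod K (enum S).
  apply/ffunP => U; rewrite sum_ffunE (bigD1 U) //= big1 => [|S SU].
    by rewrite ext_scaleE ext_prod_enum ffunE eqxx mulr1 addr0.
  by rewrite ext_scaleE ext_prod_enum ffunE eq_sym (negbTE SU) mulr0.
(* [P 0] is not among the premises; it comes from scaling [1] by [0]. *)
apply: big_ind => //; first by rewrite -(scale0r (1 : E)); apply: PZ.
move=> S _; apply: PZ; rewrite /ext_prod.
by elim: (enum S) => [|i s IHs]; rewrite ?big_nil ?big_cons //; apply: PM.
Qed.

(** Induction on the left factor, whose generator step is [ext_d_genM]; this is the graded Leibniz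
    rule. *)
Lemma ext_dM x y : ext_d (x * y) = ext_d x * y + ext_conj x * ext_d y.
Proof.
elim/ext_ind: x y => [y|x1 x2 IH1 IH2 y|c x IH y|i x IH y].
- rewrite ext_d1 mul0r add0r mul1r (_ : ext_conj 1 = 1) ?mul1r //.
  apply/ffunP => U; rewrite !ffunE; case: eqP => [->|]; last by rewrite mulr0.
  by rewrite cards0 expr0 mul1r.
- by rewrite mulrDl !linearD /= IH1 IH2 !mulrDl addrACA.
- by rewrite -ext_scalerAl !linearZ /= IH scalerDr !ext_scalerAl.
rewrite -mulrA !ext_d_genM IH ext_conjM ext_conj_gen mulrDr mulrBl !mulNr !mulrA.
by rewrite opprD addrA.
Qed.

Lemma ext_dd x : ext_d (ext_d x) = 0.
Proof.
elim/ext_ind: x => [|x y IHx IHy|c x IH|i x IH].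
- by rewrite ext_d1 linear0.
- by rewrite !linearD /= IHx IHy addr0.
- by rewrite !linearZ /= IH scaler0.
by rewrite ext_d_genM linearB /= ext_d_genM IH mulr0 subr0 subrr.
Qed.

(** Only an implication: a repeated index in [s] makes the product vanish. *)
Lemma ext_prod_supp s U : ext_prod K s U != 0 -> U = [set i in s].
Proof.
rewrite /ext_prod; elim: s U => [|i s IHs] U; rewrite ?big_nil ?big_cons.
  rewrite ffunE; case: (eqVneq U set0) => [-> _|_]; last by rewrite eqxx.
  by apply/setP => i; rewrite !inE.
rewrite ext_genM; case: ifPn => iU; last by rewrite eqxx.
case: (eqVneq ((\prod_(j <- s) ext_gen K j) (U :\ i)) 0) => [->|/IHs Us _].
  by rewrite mulr0 eqxx.
by rewrite set_cons -Us setD1K.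
Qed.

Lemma ext_d_supp x S : (forall U, U != S -> x U = 0) ->
  forall U, ext_d x U != 0 -> exists2 i, i \notin U & S = i |: U.
Proof.
move=> xS U; case: (boolP [exists i, (i \notin U) && (S == i |: U)]).
  by case/existsP => i /andP[iU /eqP SE]; exists i.
move/existsPn => noi /eqP[]; rewrite ext_dE big1 // => i iU.
by rewrite xS ?mulr0 //; have := noi i; rewrite iU eq_sym.
Qed.

End Exterior.

(** * The ideal generated by collinear triples *)

Section Quadratic.
Variables (K : comPzRingType) (n : nat) (G : matroid 'I_n) (ord : rel 'I_n).
Hypothesis simpleG : simple_matroid G.
Local Notation E := (exterior K n).
Local Notation ext_mon := (ext_mon K ord).
Implicit Types (x y a : E) (S U V X : {set 'I_n}).

Definition line_gen x := exists S,
  [/\ dependent G S, #|S| = 3%N & x = ext_d (ext_mon S)].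
Local Notation L := (ideal_gen line_gen).

Local Notation lc_proj X := (@ext_proj K n (fun U : {set 'I_n} => lc G U == X)).

Lemma ext_mon_supp S U : U != S -> ext_mon S U = 0.
Proof.
apply: contraNeq => /ext_prod_supp ->; apply/eqP/setP => i.
by rewrite inE mem_sort mem_enum.
Qed.

Lemma ext_d_mon_supp S U : ext_d (ext_mon S) U != 0 ->
  exists2 i, i \notin U & S = i |: U.
Proof. exact/ext_d_supp/ext_mon_supp. Qed.

Lemma line_ideal_scale c x : x \in L -> c *: x \in L.
Proof. by move=> Lx; rewrite -[x]mul1r ext_scalerAl ideal_genMl. Qed.

(** A generator from [S] is homogeneous of degree [#|S| - 1], which is at least two. So in degrees
    up to two, multiplying by [a] only scales by the constant term [a set0], and in degree two only
    triples contribute. The first conjunct carries the second through products. *)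
Lemma OS_ideal_low x : x \in OS_ideal ord G ->
  (forall U, (#|U| < 2)%N -> x U = 0) /\ ext_proj (fun U => #|U| == 2%N) x \in L.
Proof.
have lowE y U V : (forall U, (#|U| < 2)%N -> y U = 0) -> (#|U| <= 2)%N ->
    V \subset U -> V != U -> y V = 0.
  move=> y0 U2 VU VnU; apply: y0; apply: leq_trans U2.
  by apply: proper_card; rewrite properEneq VnU.
have setD_neq S U : S \subset U -> S != set0 -> U :\: S != U.
  move=> SU; apply: contraNneq => /setDidPl.
  by rewrite disjoint_sym -setI_eq0 (setIidPl SU).
move: x; apply: ideal_gen_ind.
- by split=> [U _|]; [rewrite ffunE|rewrite linear0 rpred0].
- move=> x1 y [x0 Lx] [y0 Ly]; split=> [U U2|]; last by rewrite linearD rpredD.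
  by rewrite ffunE x0 ?y0 ?addr0.
- move=> a y [y0 Ly]; have aE U : (#|U| <= 2)%N -> (a * y) U = a set0 * y U.
    move=> U2; rewrite ext_mulE (bigD1 set0) ?sub0set //= big1.
      by rewrite ninv0l setD0 mul1r addr0.
    by move=> S /andP[SU S0]; rewrite (lowE y U) ?subsetDl ?setD_neq // !mulr0.
  split=> [U U2|]; first by rewrite aE 1?ltnW // y0 // mulr0.
  have -> : ext_proj (fun U => #|U| == 2%N) (a * y) =
            a set0 *: ext_proj (fun U => #|U| == 2%N) y.
    apply/ffunP => U; rewrite ext_scaleE [LHS]ffunE [ext_proj _ y U]ffunE.
    by case: ifP => [/eqP U2|]; rewrite ?mulr0 // aE ?U2.
  exact: line_ideal_scale.
- move=> a y [y0 Ly]; have aE U : (#|U| <= 2)%N -> (y * a) U = a set0 * y U.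
    move=> U2; rewrite ext_mulE (bigD1 U) //= big1.
      by rewrite setDv ninv0r mul1r mulrC addr0.
    by move=> S /andP[SU SnU]; rewrite (lowE y U) // mul0r mulr0.
  split=> [U U2|]; first by rewrite aE 1?ltnW // y0 // mulr0.
  have -> : ext_proj (fun U => #|U| == 2%N) (y * a) =
            a set0 *: ext_proj (fun U => #|U| == 2%N) y.
    apply/ffunP => U; rewrite ext_scaleE [LHS]ffunE [ext_proj _ y U]ffunE.
    by case: ifP => [/eqP U2|]; rewrite ?mulr0 // aE ?U2.
  exact: line_ideal_scale.
move=> y [S dS yE]; have S3 := simple_dependent_card simpleG dS; split=> [U U2|].
  apply: contraTeq S3; rewrite yE => /ext_d_mon_supp[i iU ->].
  by rewrite cardsU1 iU add1n ltnS -ltnNge.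
case: (eqVneq #|S| 3%N) => [cS|nS].
  rewrite ext_proj_id => [|U]; first by apply: mem_ideal_gen; exists S.
  apply: contraNeq; rewrite yE => /ext_d_mon_supp[i iU SE].
  by move: cS; rewrite SE cardsU1 iU add1n => [[->]].
rewrite ext_proj_eq0 ?rpred0 // => U /eqP U2; apply: contra_neq_eq nS.
by rewrite yE => /ext_d_mon_supp[i iU ->]; rewrite cardsU1 iU U2.
Qed.

(** An element homogeneous of degree two is its own degree-two projection, so [OS_ideal_low]
    applies. *)
Lemma OS_ideal2_line x : x \in ideal_gen (OS_ideal2 ord G) -> x \in L.
Proof.
move: x; apply: ideal_gen_ind; rewrite ?rpred0 //.
- by move=> *; apply: rpredD.
- exact: ideal_genMl.
- by move=> a y; apply: ideal_genMr.
move=> y [/OS_ideal_low[_ Ly] hy]; move: Ly; rewrite ext_proj_id // => U.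
by apply: contraNeq => /hy ->.
Qed.

Lemma line_ideal_coef0 x : x \in L -> x set0 = 0.
Proof.
have sub0 (F : {set 'I_n} -> K) :
    \sum_(S : {set 'I_n} | S \subset set0) F S = F set0.
  by rewrite (eq_bigl (pred1 set0)) ?big_pred1_eq // => S; rewrite subset0.
move: x; apply: ideal_gen_ind => [|y z y0 z0|a y y0|a y y0|y];
  rewrite ?ffunE ?sub0 ?setDv //.
- by rewrite y0 z0 addr0.
- by rewrite y0 !mulr0.
- by rewrite y0 mul0r mulr0.
case=> S [_ S3 ->]; apply: contra_eq S3 => /ext_d_mon_supp[i _ ->].
by rewrite setU0 cards1.
Qed.

(** The three memberships are proved together because the Leibniz rule for [y * a] involves [y],
    [ext_d y] and [ext_conj y]. On a generator, [ext_dd] handles the derivation, and the involution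
    is trivial in degree two. *)
Lemma line_ideal_d_conj x : x \in L ->
  [/\ x \in L, ext_d x \in L & ext_conj x \in L].
Proof.
move: x; apply: ideal_gen_ind =>
  [|y z [Ly Ldy Lcy] [Lz Ldz Lcz]|a y [Ly Ldy Lcy]|a y [Ly Ldy Lcy]|y yS].
- by rewrite !linear0 rpred0.
- by rewrite !linearD !rpredD.
- by rewrite ext_dM ext_conjM ideal_genMl // rpredD ?ideal_genMl.
- by rewrite ext_dM ext_conjM ideal_genMr // rpredD ?ideal_genMr.
have Ly : y \in L by apply: mem_ideal_gen.
case: yS => S [_ S3 yE]; split=> //; first by rewrite yE ext_dd rpred0.
suff -> : ext_conj y = y by [].
apply/ffunP => U; rewrite ffunE; case: (eqVneq (y U) 0) => [->|].
  by rewrite mulr0.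
rewrite yE => /ext_d_mon_supp[i iU SE]; move: S3.
by rewrite SE cardsU1 iU add1n => [[->]]; rewrite sqrrN expr1n mul1r.
Qed.

(** * The grading by line closure *)

Lemma sum_lc_proj x : x = \sum_X lc_proj X x.
Proof.
apply/ffunP => U; rewrite sum_ffunE (bigD1 (lc G U)) //= big1 => [|X XU].
  by rewrite ffunE eqxx addr0.
by rewrite ffunE eq_sym (negbTE XU).
Qed.

(** By [lcU], all monomials occurring in the product share one line closure, so a projection keeps
    everything or nothing. The disjunction avoids naming that degree. *)
Lemma lc_projM X Y Z x y :
  lc_proj X (lc_proj Y x * lc_proj Z y) = 0 \/
  lc_proj X (lc_proj Y x * lc_proj Z y) = lc_proj Y x * lc_proj Z y.
Proof.
set w := _ * _.
have wE U V : w U != 0 -> w V != 0 -> lc G U = lc G V.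
  have wU W : w W != 0 -> exists A B, [/\ W = A :|: B, lc G A = Y & lc G B = Z].
    move=> wW; case: (boolP [exists S : {set 'I_n},
        [&& S \subset W, lc G S == Y & lc G (W :\: S) == Z]]).
      case/existsP => S /and3P[SW /eqP SY /eqP WZ]; exists S, (W :\: S); split=> //.
      by rewrite -{1}(setID W S) (setIidPr SW).
    move/existsPn => noS; case/eqP: wW; rewrite /w ext_mulE big1 // => S SW.
    have := noS S; rewrite SW /= negb_and => /orP[nY|nZ].
      by rewrite [lc_proj Y x S]ffunE (negbTE nY) mul0r mulr0.
    by rewrite [lc_proj Z y _]ffunE (negbTE nZ) !mulr0.
  move=> /wU[A [B [-> AY BZ]]] /wU[A' [B' [-> AY' BZ']]].
  by apply: lcU; congruence.
case: (boolP [exists U : {set 'I_n}, (lc G U == X) && (w U != 0)]).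
  case/existsP => U /andP[/eqP UX wU]; right; apply: ext_proj_id => V.
  by apply: contraNeq => wV; rewrite (wE V U) // UX.
move/existsPn => noU; left; apply: ext_proj_eq0 => U UX.
by have := noU U; rewrite UX /= negbK => /eqP.
Qed.

Lemma line_ideal_proj X x : x \in L -> lc_proj X x \in L.
Proof.
(* [X] stays general: for a product, the hypothesis on [y] is used in every degree. *)
move=> Lx; move: x Lx X; apply: ideal_gen_ind => [X|y z Ly Lz X|a y Ly X|a y Ly X|y].
- by rewrite linear0 rpred0.
- by rewrite linearD /= rpredD.
- rewrite (sum_lc_proj a) (sum_lc_proj y) mulr_suml.
  rewrite linear_sum /= rpred_sum // => Y _.
  rewrite mulr_sumr linear_sum /= rpred_sum // => Z _.
  by case: (lc_projM X Y Z a y) => ->; rewrite ?rpred0 // ideal_genMl.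
- rewrite (sum_lc_proj a) (sum_lc_proj y) mulr_suml.
  rewrite linear_sum /= rpred_sum // => Y _.
  rewrite mulr_sumr linear_sum /= rpred_sum // => Z _.
  by case: (lc_projM X Y Z y a) => ->; rewrite ?rpred0 // ideal_genMr.
case=> S [dS S3 yE] X.
have Ly : y \in L by apply: mem_ideal_gen; exists S.
(* Every pair in a collinear triple has the line closure of the triple, so the generator is
   homogeneous. *)
have yS U : y U != 0 -> lc G U = lc G S.
  rewrite yE => /ext_d_mon_supp[i iU SE].
  rewrite SE (lc_dependent3 simpleG iU) -?SE //.
  by move: S3; rewrite SE cardsU1 iU add1n => [[]].
case: (eqVneq (lc G S) X) => [SX|nSX].
  rewrite [lc_proj X y]ext_proj_id // => U; apply: contraNeq => /yS ->.
  exact/eqP.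
rewrite [lc_proj X y]ext_proj_eq0 ?rpred0 // => U UX.
by apply: contraNeq nSX => /yS <-.
Qed.

(** * Linear forms dual to the nbb monomials *)

Fixpoint lc_coef (s : seq 'I_n) x : K :=
  if s is i :: s' then lc_coef s' (ext_d (lc_proj (lc G [set j in s]) x))
  else x set0.

Lemma lc_coef_is_linear s : linear (lc_coef s : E -> K^o).
Proof.
elim: s => [|i s IHs] c x y /=; first by rewrite !ffunE.
by rewrite !linearP /= IHs.
Qed.
HB.instance Definition _ s := GRing.isLinear.Build K E K^o *:%R
  (lc_coef s : E -> K^o) (lc_coef_is_linear s).

Lemma lc_coef_line s x : x \in L -> lc_coef s x = 0.
Proof.
elim: s x => [|i s IHs] x Lx /=; first exact: line_ideal_coef0.
apply: IHs.
by case: (line_ideal_d_conj (line_ideal_proj (lc G [set j in i :: s]) Lx)).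
Qed.

(** The nbb condition along suffixes, matching the recursion of [lc_coef]. Minimality already forces
    [s] to be increasing for [ord]. *)
Fixpoint nbb_seq (s : seq 'I_n) :=
  if s is i :: s' then
    [&& i \notin s', is_min ord i (lc G [set j in s]) & nbb_seq s']
  else true.

Hypothesis ord_anti : antisymmetric ord.

Lemma lc_coef_genM i s x : nbb_seq (i :: s) -> lc_coef s (ext_gen K i * x) = 0.
Proof.
case: s => [_|j s]; first by rewrite /= ext_genM inE.
rewrite [nbb_seq _]/= -/(nbb_seq (j :: s)) => /and3P[nis /andP[_ /forall_inP imin]].
case/and3P=> _ /andP[jlc /forall_inP jmin] _ /=.
rewrite [lc_proj _ _]ext_proj_eq0 ?linear0 // => U /eqP UE.
rewrite ext_genM; case: ifP => // iU; case/negP: nis.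
(* [j] is below [i] as the minimum of the closure of [j :: s], and [i] is below [j] as the minimum
   of the larger closure. *)
suff -> : i = j by rewrite mem_head.
apply: ord_anti; rewrite jmin ?andbT; last by rewrite -UE (subsetP (sub_lc G U)).
by apply: imin; apply: (subsetP (sub_lc _ _)); rewrite !inE eqxx orbT.
Qed.

Lemma lc_coef_prod s t : nbb_seq s -> nbb_seq t ->
  lc_coef s (ext_prod K t) = (s == t)%:R.
Proof.
elim: s t => [|i s IHs] [|j t] ns nt.
- by rewrite /= /ext_prod big_nil ffunE eqxx.
- by rewrite /= /ext_prod big_cons ext_genM inE.
(* Here [t] is empty; so is its line closure, which cannot contain [i]. *)
- rewrite /= [lc_proj _ _]ext_proj_eq0 ?linear0 // => U /eqP UE.
  apply: contraTeq isT => /ext_prod_supp UE'; have : i \in lc G U.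
    by rewrite UE; apply: (subsetP (sub_lc _ _)); rewrite !inE eqxx.
  by rewrite UE' (_ : [set k in [::]] = set0) ?lc_set0 ?inE //.
have [st|nst] := eqVneq (lc G [set k in i :: s]) (lc G [set k in j :: t]);
  last first.
  have -> : (i :: s == j :: t) = false by apply: contraNF nst => /eqP ->.
  rewrite /= [lc_proj _ _]ext_proj_eq0 ?linear0 // => U.
  by apply: contraTeq => /ext_prod_supp ->; rewrite eq_sym.
(* Both heads are minima of the same line closure. *)
have ij : i = j.
  move: (ns) (nt) => /= /and3P[_ /andP[i_s /forall_inP si] _].
  move=> /and3P[_ /andP[j_t /forall_inP tj] _].
  by apply: ord_anti; rewrite si ?tj // ?st // -st.
subst j; rewrite /= [lc_proj _ _]ext_proj_id => [|U]; last first.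
  by apply: contraNeq => /ext_prod_supp ->; rewrite st.
rewrite {1}/ext_prod big_cons ext_d_genM linearB /= lc_coef_genM // subr0.
case/and3P: ns => _ _ ns; case/and3P: nt => _ _ nt.
by rewrite -/(ext_prod K t) IHs // eqseq_cons eqxx.
Qed.

End Quadratic.

(** * From nbb sets to sequences, and linear independence *)

Lemma nbb_seq_sort n (G : matroid 'I_n) (ord : rel 'I_n) (S : {set 'I_n}) :
  linear_order ord -> nbb G ord S -> nbb_seq G ord (sort ord (enum S)).
Proof.
case=> rf anti tr tot /forall_inP nbbS.
(* Minimality is restated on the list alone, so that the induction can pass to its tail. *)
have: forall i, i \in sort ord (enum S) ->
    is_min ord i (lc G [set j in sort ord (enum S) | ord i j]).
  move=> i; rewrite mem_sort mem_enum => /nbbS.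
  by congr (is_min ord i (lc G _)); apply/setP => j; rewrite !inE mem_sort mem_enum.
have: uniq (sort ord (enum S)) by rewrite sort_uniq enum_uniq.
have: sorted ord (sort ord (enum S)) by apply: sort_sorted.
elim: (sort ord (enum S)) => // i s IHs srt /= /andP[nis us] mins.
have /andP[/allP ile ss] : all (ord i) s && sorted ord s by rewrite -path_sortedE.
rewrite nis IHs // ?andbT => [|j js].
  have := mins i (mem_head _ _); congr (is_min ord i (lc G _)).
  apply/setP => j; rewrite !inE; case: eqP => [->|_] /=; first by rewrite rf.
  by case: (boolP (j \in s)) => // /ile.
(* Dropping the head [i] does not change the elements above [j]: [ord j i] would force [i = j]. *)
have := mins j; rewrite inE js orbT => /(_ isT); congr (is_min ord j (lc G _)).
apply/setP => k; rewrite !inE; case: eqP => //= ki.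
rewrite ki (negbTE nis); apply/negP => ji; case/negP: nis.
by suff -> : i = j by []; apply: anti; rewrite ji ile.
Qed.

Theorem theorem2p16 (K : comPzRingType) (n : nat) (G : matroid 'I_n)
    (ord : rel 'I_n) :
  simple_matroid G -> linear_order ord ->
  lin_indep (nbb G ord) (abar K ord G).
Proof.
move=> simpleG lo c sum0 S nbbS.
have anti : antisymmetric ord by case: lo.
set x := \sum_(U | nbb G ord U) c U *: ext_mon K ord U.
have /(OS_ideal2_line simpleG) Lx : x \in ideal_gen (OS_ideal2 ord G).
  have pi0 : ext_pi (OS_ideal2 ord G) 0 = 0 :> quad_closure K ord G.
    by apply: (addrI (ext_pi _ 0)); rewrite -ext_piD !addr0.
  rewrite -[x]subr0 -ext_pi_eq pi0 -sum0 /x.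
  rewrite (big_morph (ext_pi _) (@ext_piD _ _ _) pi0).
  by apply/eqP; apply: eq_bigr => U _; rewrite ext_piZ.
set s := sort ord (enum S).
have coefE U : nbb G ord U ->
    lc_coef G s (c U *: ext_mon K ord U) = c U * (s == sort ord (enum U))%:R.
  move=> nbbU; rewrite linearZ /= /ext_mon.
  by rewrite (lc_coef_prod _ anti) //; apply: nbb_seq_sort.
(* The form attached to [S] kills [x], and by duality only the term of [S] survives, with value
   [c S]. *)
have := lc_coef_line simpleG s Lx.
rewrite /x linear_sum (bigD1 S) //= big1 => [|U /andP[nbbU US]].
  by rewrite coefE // eqxx mulr1 addr0.
rewrite coefE //; case: eqP => [|_]; last by rewrite mulr0.
move=> sE; case/eqP: US; apply/setP => i.
rewrite -(mem_enum U) -(mem_enum S) -(mem_sort ord (enum U)) -sE.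
by rewrite mem_sort.
Qed.
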